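(* Suppose that there exist a constant $C\ge1$, an integer $n_0\ge1$, and a function $\psi:\mathbb N\to\mathbb R$ such that the inequality $$\Delta_n(\boldsymbol p)\le C\sqrt{\frac{S(\boldsymbol p)}{n}}+\frac{T(\boldsymbol p)}{n}\psi(n)$$ holds for all $n\ge n_0$ and all sequences $\boldsymbol p=(p(j))_{j\ge1}$ with $p(j)\in[0,\frac12]$ and $p(j)\ge p(j+1)$ for all $j$ (product measures). Then, for an integer $n_1$ and a constant $c>0$ depending only on $C$, $$\psi(n)\ge c\ln n\qquad\text{for all } n\ge \max(n_0,n_1).$$
   Context: Given $\boldsymbol p$, let $\mu$ be the product distribution on $\{0,1\}^{\mathbb N}$ under which the coordinates are independent Bernoulli variables with parameters $p(j)$. Let $X_1,\dots,X_n$ be i.i.d. samples from $\mu$, $\hat{\boldsymbol p}_n=\frac1n\sum_{i=1}^nX_i$, and $\Delta_n(\boldsymbol p)=\mathbb E\sup_{j\ge1}|\hat p_n(j)-p(j)|$. The functionals are $$S(\boldsymbol p)=\sup_{j\ge1}p(j)\ln(j+1),\qquad T(\boldsymbol p)=\sup_{j\ge1}\frac{\ln(j+1)}{\ln(1/p(j))},$$ where a term with $p(j)=0$ in $T$ is $0$. *)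

(* Defs.v *)
From HB Require Import structures.
From mathcomp Require Export all_boot all_order all_algebra.
From mathcomp Require Export finmap.
From mathcomp Require Export all_classical all_reals all_analysis.
Export Order.TTheory GRing.Theory Num.Theory.
Export numFieldNormedType.Exports.

Set Implicit Arguments.
Unset Strict Implicit.
Unset Printing Implicit Defensive.

Local Open Scope classical_set_scope.
Local Open Scope ring_scope.

(* Sequences indexed by j >= 1 are represented by functions on nat with the
   index shifted by one: p j stands for p(j + 1).  Hence the j.+2 in Sfun and Tfun
   below, where the mathematical formulas have ln (j + 1). *)

(* {0,1}^N with its product sigma-algebra, i.e. the one generated by the
   coordinate maps. *)
Definition cylinder1 : set (set (nat -> bool)) :=
  [set A | exists j b, A = [set x | x j = b]].

Notation cube := (g_sigma_algebraType cylinder1).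

Section independence.
Context (R : realType) (d d' : measure_display) (W : measurableType d)
  (V : measurableType d') (P : probability W R).

Definition mutually_independent (I : choiceType) (X : I -> W -> V) : Prop :=
  forall (J : {fset I}) (A : I -> set V), (forall i, measurable (A i)) ->
    P (\bigcap_(i in [set` J]) (X i @^-1` A i)) =
    (\prod_(i <- J) P (X i @^-1` A i))%E.

End independence.

Section sampling.
Context (R : realType).
Implicit Type p : nat -> R.

Definition bernoulli_product p (mu : probability cube R) : Prop :=
  (forall j (B : set bool),
     pushforward mu (fun x : cube => x j) B = bernoulli_prob (p j) B) /\
  mutually_independent mu (fun (j : nat) (x : cube) => x j).

Context (d : measure_display) (W : measurableType d) (P : probability W R).

Definition iid_sample (mu : probability cube R) (n : nat)
    (X : 'I_n -> {mfun W >-> cube}) : Prop :=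
  (forall i (A : set cube), measurable A -> distribution P (X i) A = mu A) /\
  mutually_independent P (fun i => X i : W -> cube).

Definition phat (n : nat) (X : 'I_n -> {mfun W >-> cube}) (w : W) (j : nat) : R :=
  n%:R^-1 * \sum_(i < n) ((X i w : cube) j)%:R.

Definition Delta p (n : nat) (X : 'I_n -> {mfun W >-> cube}) : \bar R :=
  'E_P[(fun w => sup (range (fun j : nat => `|phat X w j - p j|)))%R]%E.

End sampling.

Section functionals.
Context (R : realType).
Implicit Type p : nat -> R.

(* Sfun and Tfun may be +oo. *)
Definition Sfun p : \bar R :=
  ereal_sup (range (fun j : nat => (p j * ln j.+2%:R)%:E)).

Definition Tfun p : \bar R :=
  ereal_sup (range (fun j : nat =>
    (if p j == 0 then 0 else ln j.+2%:R / ln (p j)^-1)%:E)).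

End functionals.

(* Main.v *)
(* A sequence with only finitely many nonzero entries already forces the bound.
   Take p(j) = 1/(nM) for j <= M and p(j) = 0 afterwards, with M depending on C
   only.  With probability at least 1 - (1 - 1/(nM))^(nM) >= 1/2 one of the nM
   relevant bits of the sample equals 1; then some empirical mean is at least
   1/n, so Delta_n >= (1/n - 1/(nM))/2 >= 1/(4n).  Here
   C sqrt(S/n) = C sqrt(ln(M + 1)/M)/n is at most 1/(8n) once
   64 C^2 ln(M + 1) <= M, so T psi(n) >= 1/8 with T = ln(M + 1)/ln(nM), that is,
   psi(n) >= ln(nM)/(8 ln(M + 1)). *)
From HB Require Import structures.
Require Import Defs.
From mathcomp Require Import ring lra.

Set Implicit Arguments.
Unset Strict Implicit.
Unset Printing Implicit Defensive.

Local Open Scope classical_set_scope.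
Local Open Scope ring_scope.

(** * Finitely supported product measures and independence *)

Section finite_product.
Context (R : realType) (d : measure_display) (T : measurableType d).

(** A weighted sum of Dirac masses, built by recursion on the enumeration of [F]. A Dirac mass is an
    indicator on every set, so the formula holds for all [A]. *)
Lemma atomic_probability (F : finType) (w : F -> R) (x : F -> T) :
  (forall f, 0 <= w f) -> \sum_f w f = 1 ->
  exists P : probability T R,
    forall A, P A = (\sum_f w f * \1_A (x f))%:E.
Proof.
move=> w0 w1.
have [nu nuE] : exists nu : {measure set T -> \bar R},
    forall A, nu A = (\sum_f w f * \1_A (x f))%:E.
  elim: (index_enum F) => [|f s [nu nuE]].
    exists (@mzero _ T R : measure T R) => A.
    by rewrite big_nil.
  exists (measure_add (mscale (NngNum (w0 f)) \d_(x f)) nu) => A.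
  by rewrite [LHS]measure_addE/= nuE big_cons EFinD EFinM.
have nuT : nu setT = 1%E.
  rewrite nuE -w1; congr EFin; apply: eq_bigr => f _.
  by rewrite indicT mulr1.
(* The mass of [nu] is 1, so normalizing only turns it into a probability; the Dirac mass at [point]
   is a fallback value. *)
exists (mnormalize nu \d_(point : T)) => A.
by rewrite -nuE /= /mnormalize nuT onee_eq0/= invr1 mule1.
Qed.

Context (I G : finType) (v : G -> R).
Hypothesis v1 : \sum_g v g = 1.

(** Distributivity, read as independence: under product weights the expectation of a product over
    the factors splits. *)
Lemma expectation_prod (phi : I -> G -> R) :
  \sum_(f : {ffun I -> G}) (\prod_i v (f i)) * \prod_i phi i (f i) =
  \prod_i \sum_g v g * phi i g.
Proof.
rewrite bigA_distr_bigA; apply: eq_bigr => f _.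
by rewrite -big_split.
Qed.

Lemma product_weight1 : \sum_(f : {ffun I -> G}) \prod_i v (f i) = 1.
Proof.
by rewrite -(bigA_distr_bigA (fun _ : I => v)) big1.
Qed.

(** Filling with 1 outside [J] makes the first product run over all of [I], the form required by
    [expectation_prod]; the second one collects the constant coordinates. *)
Lemma prod_embedding (K : choiceType) (iota : I -> K) (J : {fset K}) (F : K -> R) :
  injective iota ->
  \prod_(k <- J) F k =
  (\prod_i if iota i \in J then F (iota i) else 1) *
  \prod_(k <- J | k \notin codom iota) F k.
Proof.
move=> iotaI; rewrite (bigID (mem (codom iota)))/=; congr *%R.
rewrite -big_filter (perm_big [seq iota i | i <- enum I & iota i \in J]).
  by rewrite big_map big_filter big_enum_cond big_mkcond.
apply: uniq_perm.
- by rewrite filter_uniq// fset_uniq.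
- by rewrite map_inj_uniq// filter_uniq// enum_uniq.
move=> k; rewrite mem_filter; apply/andP/mapP.
  move=> [/codomP[i ->] iJ]; exists i => //.
  by rewrite mem_filter iJ mem_enum.
move=> [i]; rewrite mem_filter => /andP[iJ _] ->.
by rewrite codom_f.
Qed.

Lemma indic_bigcap_fset (U : Type) (K : choiceType) (J : {fset K})
    (A : K -> set U) (u : U) :
  \1_(\bigcap_(k in [set` J]) A k) u = \prod_(k <- J) \1_(A k) u :> R.
Proof.
rewrite bigcap_fset.
apply: (big_morph (fun B : set U => \1_B u : R)) => [B B'|].
  by rewrite indicI.
by rewrite indicT.
Qed.

(* The coordinates X k are indexed by K: those with k = iota i depend only on the
   i-th factor, all the others are constant. *)
Context (x : {ffun I -> G} -> T) (P : probability T R).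
Hypothesis PE : forall A,
  P A = (\sum_(f : {ffun I -> G}) (\prod_i v (f i)) * \1_A (x f))%:E.
Context (d' : measure_display) (V : measurableType d').
Context (K : choiceType) (iota : I -> K).
Context (h : I -> G -> V) (c : K -> V) (X : K -> T -> V).
Hypothesis iotaI : injective iota.
Hypothesis Xiota : forall i f, X (iota i) (x f) = h i (f i).
Hypothesis Xcst : forall k f, k \notin codom iota -> X k (x f) = c k.

Lemma product_marginal i (B : set V) :
  P (X (iota i) @^-1` B) = (\sum_g v g * \1_B (h i g))%:E.
Proof.
rewrite PE; congr EFin.
transitivity (\prod_j \sum_g v g * (if j == i then \1_B (h i g) else 1)).
  rewrite -expectation_prod; apply: eq_bigr => f _; congr *%R.
  by rewrite -big_mkcond/= big_pred1_eq !indicE/= -Xiota.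
rewrite (bigD1 i)//= [X in _ * X]big1 ?mulr1; last first.
  move=> j /negPf ->; rewrite -[RHS]v1; apply: eq_bigr => g _.
  by rewrite mulr1.
by rewrite eqxx.
Qed.

Lemma constant_marginal k (B : set V) :
  k \notin codom iota -> P (X k @^-1` B) = (\1_B (c k))%:E.
Proof.
move=> kN; rewrite PE; congr EFin.
rewrite -[RHS]mul1r -[Y in _ = Y * _]product_weight1 mulr_suml.
apply: eq_bigr => f _.
by rewrite !indicE/= -(Xcst f kN).
Qed.

(** The indicator of an intersection is a product of indicators. Those of the constant coordinates
    factor out of the sum, and [expectation_prod] splits the rest. *)
Lemma product_independent : mutually_independent P X.
Proof.
move=> J A _.
have -> : (\prod_(k <- J) P (X k @^-1` A k))%E =
    (\prod_(k <- J) fine (P (X k @^-1` A k)))%:E.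
  by rewrite -prodEFin; apply: eq_bigr => k _; rewrite PE.
rewrite PE; congr EFin; rewrite (prod_embedding _ _ iotaI).
transitivity ((\prod_i \sum_g v g *
    (if iota i \in J then \1_(A (iota i)) (h i g) else 1)) *
  \prod_(k <- J | k \notin codom iota) \1_(A k) (c k)); last first.
  congr *%R; last first.
    by apply: eq_bigr => k kN; rewrite constant_marginal.
  apply: eq_bigr => i _; case: ifP => _; first by rewrite product_marginal.
  by rewrite -[RHS]v1; apply: eq_bigr => g _; rewrite mulr1.
rewrite -expectation_prod mulr_suml; apply: eq_bigr => f _.
rewrite -mulrA; congr *%R.
rewrite indic_bigcap_fset (prod_embedding _ _ iotaI); congr *%R.
  by apply: eq_bigr => i _; case: ifP => // _; rewrite !indicE/= -Xiota.
by apply: eq_bigr => k kN; rewrite !indicE/= -(Xcst f kN).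
Qed.

End finite_product.

(** * Construction of the Bernoulli law and of its sample *)

Definition pad_false (m : nat) (g : {ffun 'I_m -> bool}) : cube :=
  fun j => if insub j is Some i then g i else false.

(** The product construction is applied twice: to the m bits of one point, then to the n points of
    the sample. An n by m array of bits is coded by a natural number, so that the sample space is
    the discrete [nat], on which every map is measurable. *)
Lemma bernoulli_product_sample (R : realType) (m n : nat) (q : R) :
  0 <= q <= 1 ->
  exists (mu : probability cube R) (P : probability nat R)
         (X : 'I_n -> {mfun nat >-> cube}),
    [/\ bernoulli_product (fun j => if (j < m)%N then q else 0) mu,
        iid_sample P mu X &
        P [set w | forall i j, (j < m)%N -> (X i w : cube) j = false] =
        ((1 - q) ^+ (m * n))%:E].
Proof.
move=> q01; have /andP[q0 q1] := q01.
pose v (b : bool) : R := if b then q else 1 - q.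
have v0 b : 0 <= v b by case: b; rewrite /v// subr_ge0.
have v1 : \sum_b v b = 1 by rewrite big_bool/= addrC subrK.
pose v2 (g : {ffun 'I_m -> bool}) := \prod_j v (g j).
have v20 g : 0 <= v2 g by apply: prodr_ge0.
have v21 : \sum_g v2 g = 1 := product_weight1 _ v1.
have [mu muE] := atomic_probability (T := cube) (@pad_false m) v20 v21.
have w0 (f : {ffun 'I_n -> {ffun 'I_m -> bool}}) : 0 <= \prod_i v2 (f i).
  by apply: prodr_ge0.
have [P PE] := atomic_probability (T := nat) choice.pickle w0 (product_weight1 _ v21).
pose X0 (i : 'I_n) (w : nat) : cube :=
  if choice.unpickle w is Some f
  then pad_false ((f : {ffun 'I_n -> {ffun 'I_m -> bool}}) i)
  else fun=> false.
have mX0 i : measurable_fun setT (X0 i) by [].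
pose X i : {mfun nat >-> cube} :=
  HB.pack (X0 i) (isMeasurableFun.Build _ _ _ _ (X0 i) (mX0 i)).
have XE i (f : {ffun 'I_n -> {ffun 'I_m -> bool}}) :
    X i (choice.pickle f) = pad_false (f i).
  by rewrite /X/= /X0 choice.pickleK.
have pad_val (j : 'I_m) g : pad_false g j = g j by rewrite /pad_false valK.
have not_codom k : (k \notin codom (val : 'I_m -> nat)) = (m <= k)%N.
  rewrite leqNgt; congr negb; apply/codomP/idP; first by move=> [i ->]; exact: ltn_ord.
  by move=> km; exists (Ordinal km).
have pad_cst k (g : {ffun 'I_m -> bool}) :
    k \notin codom (val : 'I_m -> nat) -> pad_false g k = false.
  by rewrite not_codom /pad_false leqNgt => mk; rewrite insubN.
exists mu, P, X; split.
- split.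
    move=> j B; rewrite /pushforward.
    (* A coordinate below m is a factor; a later one is constantly false, which is Bernoulli with
       parameter 0. *)
    have [jm|mj] := ltnP j m.
      have := @product_marginal R _ _ _ _ _ v1 _ mu muE _ bool _ val (fun _ b => b)
        (fun j x => x j) (fun i f => pad_val i f) (Ordinal jm) B.
      move=> /= ->; rewrite big_bool/= bernoulli_probE//.
    have := @constant_marginal R _ _ _ _ _ v1 _ mu muE _ bool _ val (fun _ => false)
        (fun j x => x j) (fun i f => pad_cst i f) j B.
    rewrite not_codom => /(_ mj) ->.
    rewrite bernoulli_probE ?lexx ?ler01// mul0e add0e.
    by rewrite /unstable.onem subr0 mul1e.
  exact: (@product_independent R _ _ _ _ _ v1 _ mu muE _ bool _ val (fun _ b => b)
    (fun _ => false) (fun j x => x j) val_inj (fun i f => pad_val i f)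
    (fun i f => pad_cst i f)).
- split.
    move=> i A mA; rewrite /distribution /pushforward.
    have := @product_marginal R _ _ _ _ _ v21 _ P PE _ cube _ id
      (fun _ => @pad_false m) X XE i A.
    by move=> ->; rewrite muE.
  (* With [iota] the identity there are no constant coordinates, and [point] is a dummy value. *)
  apply: (@product_independent R _ _ _ _ _ v21 _ P PE _ cube _ id
    (fun _ => @pad_false m) (fun _ => point) X (@inj_id _) XE).
  by move=> k f; rewrite codom_f.
rewrite PE; congr EFin.
(* The event says that each of the n rows is zero; a zero row has weight (1 - q)^m. *)
transitivity (\prod_(i < n) \sum_g v2 g * \1_[set [ffun=> false]] g).
  rewrite -expectation_prod; apply: eq_bigr => f _; congr *%R.
  rewrite indicE; under eq_bigr do rewrite indicE.
  have [fF|] := pselect (forall i, f i = [ffun=> false]).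
    rewrite mem_set/=; last first.
      by move=> i j jm; rewrite [X0 _ _]XE fF -[j]/(val (Ordinal jm)) pad_val ffunE.
    by rewrite big1// => i _; rewrite fF mem_set.
  move=> /existsNP[i fi]; rewrite (bigD1 i)//= [f i \in _]memNset// mul0r.
  rewrite memNset//= => XF; apply: fi; apply/ffunP => j.
  by rewrite ffunE -(pad_val j) -XE; exact: XF.
under eq_bigr => i _.
  rewrite (bigD1 [ffun=> false])//= big1 ?addr0; last first.
    by move=> g /eqP gF; rewrite indicE memNset// mulr0.
  rewrite indicE mem_set// mulr1 /v2.
  under eq_bigr do rewrite ffunE.
  rewrite prodr_const card_ord.
  over.
by rewrite prodr_const card_ord exprM.
Qed.

(** * Lower bound for the expected maximal deviation *)

Section Delta_lower_bound.
Context (R : realType) (n : nat) (P : probability nat R).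
Context (X : 'I_n -> {mfun nat >-> cube}) (p : nat -> R).
Hypothesis n0 : (0 < n)%N.
Hypothesis p01 : forall j, 0 <= p j <= 1.

Lemma phat_itv w j : 0 <= phat R X w j <= 1.
Proof.
rewrite /phat mulr_ge0 ?invr_ge0 ?ler0n ?sumr_ge0//=.
rewrite mulrC ler_pdivrMr ?ltr0n// mul1r.
rewrite (@le_trans _ _ (\sum_(i < n) 1))//.
  by apply: ler_sum => i _; rewrite lern1; case: (_ j).
by rewrite sumr_const card_ord.
Qed.

(** A real [sup] dominates its set only if the set is bounded; here all deviations are at most 1. *)
Lemma dev_le_sup w j :
  `|phat R X w j - p j| <= sup (range (fun j : nat => `|phat R X w j - p j|)).
Proof.
apply: ub_le_sup; last by exists j.
exists 1 => _ [k _ <-].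
have /andP[p0 p1] := p01 k; have /andP[h0 h1] := phat_itv w k.
by rewrite ler_norml; apply/andP; split; lra.
Qed.

Lemma hit_le_phat w i j : (X i w : cube) j -> n%:R^-1 <= phat R X w j.
Proof.
move=> Xij; rewrite /phat ler_peMr ?invr_ge0 ?ler0n//.
by rewrite (bigD1 i)//= Xij lerDl sumr_ge0.
Qed.

Lemma Delta_lower_bound (m : nat) (q : R) (r : R) :
  (forall j, (j < m)%N -> p j = q) -> q <= n%:R^-1 ->
  P [set w | forall i j, (j < m)%N -> (X i w : cube) j = false] = r%:E ->
  (((n%:R^-1 - q) * (1 - r))%:E <= Delta P p X)%E.
Proof.
move=> pq qn Pr; set N := [set w | _] in Pr.
have PN : P (~` N) = (1 - r)%:E.
  by rewrite probability_setC// Pr.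
rewrite /Delta unlock EFinM -PN -(setIT (~` N)).
rewrite -integral_indic// -ge0_integralZl//; last by rewrite lee_fin subr_ge0.
apply: ge0_le_integral => //.
- by move=> w _; rewrite mule_ge0// lee_fin// subr_ge0.
move=> w _; rewrite -EFinM lee_fin indicE.
have [Nw|NCw] := pselect (N w).
  (* When all bits vanish the minorant is 0, and the deviation at index 0 shows that the supremum is
     nonnegative. *)
  by rewrite memNset ?mulr0 ?(le_trans _ (dev_le_sup w 0%N))//; exact.
rewrite mem_set// mulr1.
have /existsNP[i /existsNP[j /not_implyP[jm /eqP]]] := NCw.
rewrite eqbF_neg negbK => Xij; apply: le_trans (dev_le_sup w j).
by rewrite (pq j jm) (le_trans _ (ler_norm _))// lerB ?(hit_le_phat Xij).
Qed.

End Delta_lower_bound.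

(** * The functionals S and T on a step sequence *)

Lemma ereal_sup_range_max (R : realType) (f : nat -> R) (k : nat) :
  (forall j, f j <= f k) -> ereal_sup (range (fun j => (f j)%:E)) = (f k)%:E.
Proof.
move=> fk; apply/eqP; rewrite eq_le; apply/andP; split.
  by apply: ge_ereal_sup => _ [j _ <-]; rewrite lee_fin.
by apply: ereal_sup_ubound; exists k.
Qed.

Section step_sequence.
Context (R : realType) (m : nat) (q : R).
Let p (j : nat) : R := if (j < m.+1)%N then q else 0.

Lemma Sfun_step : 0 <= q -> Sfun p = (q * ln m.+2%:R)%:E.
Proof.
move=> q0; rewrite /Sfun (@ereal_sup_range_max _ _ m) /p ?ltnSn// => j.
have l0 k : 0 <= ln k.+1%:R :> R by rewrite ln_ge0// ler1n.
case: ifP => jm; last by rewrite mul0r mulr_ge0.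
by rewrite ler_wpM2l// ler_ln ?posrE ?ltr0n// ler_nat.
Qed.

Lemma Tfun_step : 0 < q <= 1 -> Tfun p = (ln m.+2%:R / ln q^-1)%:E.
Proof.
move=> /andP[q0 q1]; have qN0 : q == 0 = false by rewrite gt_eqF.
have l0 k : 0 <= ln k.+1%:R :> R by rewrite ln_ge0// ler1n.
have lq : 0 <= (ln q^-1)^-1 by rewrite invr_ge0 ln_ge0// invf_ge1.
rewrite /Tfun (@ereal_sup_range_max _ _ m) /p ?ltnSn ?qN0// => j.
case: ltnP => jm; last by rewrite eqxx mulr_ge0.
by rewrite qN0 ler_wpM2r// ler_ln ?posrE ?ltr0n// ler_nat.
Qed.

End step_sequence.

(** * Elementary inequalities *)

Lemma expr_onem_inv_le (R : realType) (N : nat) : (0 < N)%N ->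
  (1 - N%:R^-1) ^+ N <= 2^-1 :> R.
Proof.
move=> N0; have NR : 0 < N%:R :> R by rewrite ltr0n.
have e2 : 2 <= expR 1 :> R by have := expR_ge1Dx (1 : R); lra.
(* From 1 - x <= exp(-x) at x = 1/N the power is at most 1/e, and e >= 2. *)
apply: (@le_trans _ _ (expR (- 1))); last first.
  by rewrite expRN lef_pV2 ?posrE ?expR_gt0//; lra.
have -> : - 1 = - N%:R^-1 * N%:R :> R by rewrite mulNr mulVf// gt_eqF.
rewrite expRM_natr; apply: lerXn2r; rewrite ?nnegrE ?expR_ge0//.
  by rewrite subr_ge0 invf_le1// ler1n.
exact: expR_ge1Dx.
Qed.

Lemma ln_sublinear (R : realType) (A : R) :
  exists m : nat, (0 < m)%N /\ A * ln m.+2%:R <= m.+1%:R.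
Proof.
wlog A0 : A / 0 <= A.
  move=> wl; have [/wl//|A0] := leP 0 A.
  exists 1%N; split => //; apply: (@le_trans _ _ 0) => //.
  by rewrite mulr_le0_ge0 ?ln_ge0 ?ler1n// ltW.
have [k Ak] : exists k : nat, 2 * A <= k%:R.
  exists (Num.truncn (2 * A)).+1; exact/ltW/truncnS_gt.
(* This makes m + 2 = (k + 2)^2, whose logarithm is at most 2(k + 1), while m + 1 = (k + 1)(k + 3)
   and 2A <= k. *)
exists (k * (k + 4)).+2; split => //.
have -> : (k * (k + 4)).+4%:R = (k%:R + 2) ^+ 2 :> R.
  by rewrite -addn4 natrD natrM natrD; ring.
have -> : (k * (k + 4)).+3%:R = (k%:R + 2) ^+ 2 - 1 :> R.
  by rewrite -addn3 natrD natrM natrD; ring.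
have k0 : 0 <= k%:R :> R by [].
rewrite lnXn; last by lra.
have Lk : ln (k%:R + 2) <= k%:R + 1 :> R.
  have -> : k%:R + 2 = 1 + (k%:R + 1) :> R by ring.
  by apply: le_ln1Dx; lra.
set L := ln _ in Lk *.
have : A * L <= A * (k%:R + 1) by rewrite ler_wpM2l.
rewrite -mulr_natl; nra.
Qed.

(** * Choice of the parameters and conclusion *)

Theorem theorem2 (R : realType) (C : R) (hC : 1 <= C) :
  exists (n1 : nat) (c : R), 0 < c /\
  forall (n0 : nat) (psi : nat -> R), (1 <= n0)%N ->
    (forall (n : nat) (p : nat -> R), (n0 <= n)%N ->
       (forall j : nat, 0 <= p j <= 2^-1) ->
       (forall j : nat, p j.+1 <= p j) ->
       forall (mu : probability cube R), bernoulli_product p mu ->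
       forall (d : measure_display) (W : measurableType d)
         (P : probability W R) (X : 'I_n -> {mfun W >-> cube}),
         iid_sample P mu X ->
         (Delta P p X <=
          C%:E * sqrte (Sfun p / n%:R%:E) + Tfun p / n%:R%:E * (psi n)%:E)%E) ->
    forall n : nat, (maxn n0 n1 <= n)%N -> c * ln n%:R <= psi n.
Proof.
have C0 : 0 < C by lra.
have [m [m0 mC]] := ln_sublinear (64 * C ^+ 2).
set L := ln _ in mC.
have L0 : 0 < L by rewrite ln_gt0// ltr1n.
(* [L] is ln(M + 1) for the support size M = [m.+1], chosen from C alone; no threshold beyond [n0]
   arises. *)
exists 0%N, (8 * L)^-1; split; first by rewrite invr_gt0 mulr_gt0.
move=> n0 psi n0_gt0 Hpsi n; rewrite maxn0 => n0n.
have n_gt0 : (0 < n)%N by exact: leq_trans n0n.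
have nR : 0 < n%:R :> R by rewrite ltr0n.
have n1 : 1 <= n%:R :> R by rewrite ler1n.
(* M >= 2 gives q <= 1/(2n), hence both q <= 1/2 and a gap 1/n - q of at least 1/(2n). *)
have mR : 2 <= m.+1%:R :> R by rewrite ler_nat.
pose M : R := m.+1%:R.
have M0 : 0 < M by rewrite /M ltr0n.
pose q : R := (m.+1 * n)%:R^-1.
have qE : q = n%:R^-1 * M^-1 by rewrite /q natrM invfM mulrC.
have q0 : 0 < q by rewrite invr_gt0 ltr0n muln_gt0.
have qn : q <= n%:R^-1 / 2.
  by rewrite qE ler_pM2l ?invr_gt0// lef_pV2 ?posrE.
have nV1 : n%:R^-1 <= 1 :> R by rewrite invf_le1.
have nV0 : 0 < n%:R^-1 :> R by rewrite invr_gt0.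
have q2 : q <= 2^-1 by lra.
have q01 : 0 <= q <= 1 by apply/andP; split; lra.
pose p j : R := if (j < m.+1)%N then q else 0.
have p2 j : 0 <= p j <= 2^-1.
  by rewrite /p; case: ifP => _; apply/andP; split; lra.
have pS j : p j.+1 <= p j.
  rewrite /p; case: ifPn => [jm|_]; first by rewrite (ltnW jm).
  by case: ifP => _; lra.
have [mu [P [X [muX PX Pnone]]]] := bernoulli_product_sample m.+1 n q01.
have p01 j : 0 <= p j <= 1 by have /andP[pj0 pj2] := p2 j; apply/andP; split; lra.
have pq j : (j < m.+1)%N -> p j = q by rewrite /p => ->.
have qn1 : q <= n%:R^-1 by lra.
have := Hpsi n p n0n p2 pS mu muX _ _ P X PX.
move=> /(le_trans (Delta_lower_bound n_gt0 p01 pq qn1 Pnone)).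
have SE : Sfun p = (q * L)%:E := Sfun_step m (ltW q0).
have TE : Tfun p = (L / ln q^-1)%:E.
  by apply: Tfun_step; rewrite q0; case/andP: q01.
rewrite SE TE => H.
(* Here S/n = (L/M)/n^2, and [mC] gives L/M <= 1/(64 C^2). *)
have Sle : (sqrte ((q * L)%:E / n%:R%:E) <= ((8 * C * n%:R)^-1)%:E)%E.
  rewrite inver gt_eqF// -EFinM.
  have -> : ((8 * C * n%:R)^-1)%:E = sqrte (((8 * C * n%:R)^-1 ^+ 2)%:E).
    by rewrite /= sqrtr_sqr ger0_norm// invr_ge0 !mulr_ge0// ltW.
  rewrite lee_sqrt ?lee_fin ?sqr_ge0//.
  have -> : q * L * n%:R^-1 = L / M * n%:R^-1 ^+ 2 by rewrite qE; ring.
  have -> : (8 * C * n%:R)^-1 ^+ 2 = (64 * C ^+ 2)^-1 * n%:R^-1 ^+ 2.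
    by field; rewrite !gt_eqF.
  by rewrite ler_wpM2r ?sqr_ge0// ler_pdivrMr// ler_pdivlMl// mulr_gt0// exprn_gt0.
have none_le : (1 - q) ^+ (m.+1 * n) <= 2^-1.
  by apply: expr_onem_inv_le; rewrite muln_gt0.
(* The factor 1/4 combines the gap 1/(2n) with the probability 1/2 of a nonzero bit. *)
have {}H : n%:R^-1 / 4 <= C * (8 * C * n%:R)^-1 + L / ln q^-1 * n%:R^-1 * psi n.
  rewrite -lee_fin; apply: le_trans (le_trans H _).
    rewrite lee_fin.
    have : 2^-1 <= 1 - (1 - q) ^+ (m.+1 * n) by lra.
    set r := (1 - q) ^+ _ => r2; nra.
  rewrite EFinD (EFinM C) [(L / _ * _ * _)%:E]EFinM [(L / _ * _)%:E]EFinM.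
  rewrite inver gt_eqF// in Sle *.
  by apply: leeD2r; apply: lee_wpmul2l; rewrite // lee_fin ltW.
have CV : C * (8 * C * n%:R)^-1 = n%:R^-1 / 8.
  by field; rewrite !gt_eqF.
rewrite {}CV in H.
have lnq : ln n%:R <= ln q^-1.
  rewrite invrK ler_ln ?posrE ?ltr0n ?muln_gt0//.
  by rewrite ler_nat leq_pmull.
(* Since 1/q = Mn with M >= 2, this holds even at n = 1, where ln n = 0. *)
have lnq0 : 0 < ln q^-1.
  rewrite ln_gt0// invrK ltr1n.
  by rewrite (leq_trans _ (leq_pmulr _ n_gt0)).
have {}H : 8^-1 <= L / ln q^-1 * psi n.
  rewrite -(ler_pM2l nV0).
  have -> : n%:R^-1 * (L / ln q^-1 * psi n) = L / ln q^-1 * n%:R^-1 * psi n by ring.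
  lra.
rewrite (le_trans (y := (8 * L)^-1 * ln q^-1))//.
  by rewrite ler_pM2l// invr_gt0 mulr_gt0.
have -> : psi n = (L^-1 * ln q^-1) * (L / ln q^-1 * psi n).
  by field; rewrite !gt_eqF.
have -> : (8 * L)^-1 * ln q^-1 = L^-1 * ln q^-1 / 8 by rewrite invfM; ring.
rewrite ler_pM2l//.
by rewrite mulr_gt0 ?invr_gt0.
Qed.
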